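(* Let $m>2$ be an integer and suppose $n=2^m-1=r_1\cdot r_2$ with $\gcd(r_1,r_2)=1$, $r_1,r_2>1$, and $\mathrm{Ord}_{r_1}(2)=m$. Let $\mathcal C=R(1,m)$ be the first-order Reed-Muller code of length $2^m$, with error-correction capability $t$. Put $$\lambda_0=\max\left\{\lambda\in\mathbb Z_{\ge1} : m<\left\lceil \frac{r_1}{\lambda}\right\rceil\right\},\qquad s=(\lambda_0+1)\cdot r_2-1 .$$ Then one can correct up to $s$ errors by using Algorithm II, for error vectors of weight at most $t$. That is, let $\varphi:\mathbb Z_n\to\mathbb Z_{r_1}\times\mathbb Z_{r_2}$ be any group isomorphism and let $$I=\{0\}\cup\{\alpha^i : i\in\varphi^{-1}(\Gamma)\},\qquad \Gamma=\{(i_1,0)\in\mathbb Z_{r_1}\times\mathbb Z_{r_2} : 0\le i_1<m\}.$$ Then $I$ is an information set for $\mathcal C$, and Algorithm II, run with $I$, any parity check matrix $H$ of $\mathcal C$ in standard form with respect to $I$, and $P=\langle T_\alpha\rangle\subseteq \mathrm{PAut}(\mathcal C^* )$, outputs $c$ on input $r=c+e$ for every $c\in\mathcal C$ and every $e\in\mathbb F G$ with $\omega(e)\le s$ and $\omega(e)\le t$.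
   Context: Ambient space. $\mathbb F=\mathbb F_2$; $G$ is the additive group of the field $\mathbb F_{2^m}$, $n=2^m-1$, $G^*=G\setminus\{0\}$, and $\alpha$ is a fixed generator of the cyclic multiplicative group $G^*$ (a primitive $n$-th root of unity). Elements of the group algebra $\mathbb F G$ are written $bX^0+\sum_{i=0}^{n-1}a_iX^{\alpha^i}$ with $b,a_i\in\mathbb F$; positions are indexed by elements of $G$. The weight $\omega(v)$ of a vector is its number of nonzero entries. The error-correction capability of a nonzero code with minimum distance $d$ is $t=\lfloor(d-1)/2\rfloor$. $\mathrm{Ord}_{r}(2)$ is the multiplicative order of $2$ modulo $r$. Reed-Muller code. For $0\le i\le n$ let $\phi_i\left(bX^0+\sum_{j}a_jX^{\alpha^j}\right)=b\,0^i+\sum_{j=0}^{n-1}a_j\alpha^{ij}\in\mathbb F_{2^m}$, with $0^0=1$. For an integer $i\ge 0$, $\mathrm{wt}(i)$ is the number of ones in its binary expansion. $R(1,m)$ is the code in $\mathbb F G$ with defining set $\{i: 0\le i<2^m-1,\ \mathrm{wt}(i)<m-1\}$, i.e. $R(1,m)=\{x\in\mathbb F G:\phi_i(x)=0 \text{ for all such } i\}$. It is a binary $[2^m,m+1,2^{m-1}]$ code. It is affine-invariant: its codewords satisfy $b+\sum_i a_i=0$, and every map $x\mapsto ax+b$ of $G$ ($a\in G^*$, $b\in G$) preserves it. Permutations. $S_G$ is the group of permutations of the set $G$, acting on $\mathbb F G$ by $\tau\left(bX^0+\sum_i a_iX^{\alpha^i}\right)=bX^{\tau(0)}+\sum_i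 a_iX^{\tau(\alpha^i)}$; $\mathrm{PAut}(\mathcal C)=\{\tau\in S_G:\tau(\mathcal C)=\mathcal C\}$. $\mathcal C^*$ is the code obtained from $\mathcal C$ by puncturing at the position $X^0$; permutations of $G^*$ preserving $\mathcal C^*$ form $\mathrm{PAut}(\mathcal C^* )$ and are identified with their extensions to $G$ fixing $0$, so $\mathrm{PAut}(\mathcal C^* )\subseteq\mathrm{PAut}(\mathcal C)$. $T_\alpha$ is the permutation of $G$ with $T_\alpha(0)=0$ and $T_\alpha(\alpha^i)=\alpha^{i+1}$, and $\langle T_\alpha\rangle$ is the cyclic group it generates. Information sets. For a code $\mathcal C$ of dimension $k$, a set $I\subseteq G$ is an information set if $|I|=k$ and the projection of $\mathcal C$ onto the positions in $I$ is all of $\mathbb F^{|I|}$. A parity check matrix $H$ of $\mathcal C$ (rows forming a basis of the dual code) is in standard form with respect to $I$ if its columns at the positions not in $I$ are the columns of the identity matrix of order $2^m-k$. Algorithm II. For $k=0,\dots,n-1$ let $\sigma_k\in\mathrm{PAut}(\mathcal C)$ be the translation $x\mapsto x+\alpha^k$ of $G$, and let $\Sigma$ be the ordered set $(1_G,\sigma_0,\dots,\sigma_{n-1})$, where $1_G$ is the identity. Given an information set $I$, a parity check matrix $H$ in standard form with respect to $I$, a set $P\subseteq\mathrm{PAut}(\mathcal C^* )$ and a received word $r\in\mathbb F G$: run through the elements $\sigma$ of $\Sigma$ in order and, for each, through all $\tau\in P$ (in any fixed order), until a pair $(\sigma,\tau_0)$ is found with $\omega\left(H\cdot\tau_0(\sigma(r))^T\right)\le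 t$. Then let $c'\in\mathcal C$ be the unique codeword agreeing with $\tau_0(\sigma(r))$ on the positions in $I$, and output $\sigma^{-1}(\tau_0^{-1}(c'))$. *)

(* Defs.v *)
From mathcomp Require Import all_boot all_order all_algebra all_fingroup.
Set Implicit Arguments.
Unset Strict Implicit.
Unset Printing Implicit Defensive.
Import Order.TTheory GRing.Theory Num.Theory.
Local Open Scope ring_scope.

(* Binary words with positions indexed by T; the group algebra F_2[G] is
   word G, the coefficient of X^g in x being entry x g. *)
Notation word T := 'rV['F_2]_#|T|.

Section Words.
Variable T : finType.
Implicit Types (x y : word T) (C : {set word T}) (A I : {set T}).

Definition entry x (g : T) : 'F_2 := x 0 (enum_rank g).

Definition wgt p q (v : 'M['F_2]_(p, q)) : nat :=
  #|[set ij : 'I_p * 'I_q | v ij.1 ij.2 != 0]|.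

(* The coefficient x_g is moved to position tau g. *)
Definition permute (tau : {perm T}) x : word T :=
  \row_j entry x ((tau^-1)%g (enum_val j)).

Definition PAut C : {set {perm T}} := [set tau | permute tau @: C == C].

Definition positions A : finType := {g : T | g \in A}.

Definition restrict A x : word (positions A) :=
  \row_j entry x (val (enum_val j)).

Definition mindist C : nat :=
  \big[minn/#|T|]_(p : word T * word T
    | [&& p.1 \in C, p.2 \in C & p.1 != p.2]) wgt (p.1 - p.2).

Definition capability C : nat := (mindist C - 1) %/ 2.

(* The codes used below are linear, so that the span of C is C itself. *)
Definition dimension C : nat := \dim <<enum C>>%VS.

Definition dual C : {set word T} :=
  [set y | [forall x in C, y *m x^T == 0]].

Definition information_set C I : Prop :=
  #|I| = dimension C /\ restrict I @: C = [set: word (positions I)].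

Definition parity_check_matrix C (H : 'M['F_2]_(#|T| - dimension C, #|T|)) :=
  basis_of <<enum (dual C)>>%VS
    [seq row j H | j <- enum 'I_(#|T| - dimension C)].

(* Positions carry no preferred order, so the identity matrix may appear for
   any enumeration f of the complement of I. *)
Definition standard_form I q (H : 'M['F_2]_(q, #|T|)) : Prop :=
  exists f : 'I_q -> T,
    [/\ injective f, f @: [set: 'I_q] = ~: I
      & colsub (enum_rank \o f) H = 1%:M].

End Words.

Arguments parity_check_matrix {T} C H.

Section FieldCodes.
Variable K : finFieldType.
Implicit Types (x r : word K) (C : {set word K}) (I : {set K}) (alpha : K).

(* Bits of index j >= i vanish because i < 2 ^ i. *)
Definition binary_weight (i : nat) : nat := \sum_(j < i) odd (i %/ 2 ^ j).

Definition power_sum (i : nat) x : K :=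
  \sum_(g : K) (nat_of_ord (entry x g))%:R * g ^+ i.

(* K is meant to be the field with 2 ^ m elements. *)
Definition RM1 (m : nat) : {set word K} :=
  [set x | [forall i : 'I_(2 ^ m - 1),
    (binary_weight i < m - 1)%N ==> (power_sum i x == 0)]].

(* Permutations of K^* preserving the code punctured at 0, each identified
   with its extension to K fixing 0. *)
Definition PAut_punctured C : {set {perm K}} :=
  [set tau : {perm K} | (tau 0 == 0) &&
    [exists rho in PAut (restrict [set~ 0] @: C),
      [forall g, tau (val g) == val (rho g)]]].

Definition translation (a : K) : {perm K} := perm (@addIr K a).

Definition Sigma alpha : seq {perm K} :=
  1%g :: [seq translation (alpha ^+ k) | k <- iota 0 (#|K| - 1)].

(* P lists the permutations in the order in which they are tried; None means
   that no pair (sigma, tau) passes the test. *)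
Definition algorithmII C alpha I q (H : 'M['F_2]_(q, #|K|))
    (P : seq {perm K}) r : option (word K) :=
  let passes st :=
    (wgt (H *m (permute st.2 (permute st.1 r))^T) <= capability C)%N in
  match [seq st <- [seq (sigma, tau) | sigma <- Sigma alpha, tau <- P]
        | passes st] with
  | [::] => None
  | (sigma, tau) :: _ =>
      omap (fun c => permute (sigma^-1)%g (permute (tau^-1)%g c))
        [pick c in C | restrict I c
                         == restrict I (permute tau (permute sigma r))]
  end.

Definition Gamma (m r1 r2 : nat) : {set 'Z_r1 * 'Z_r2} :=
  [set i : 'Z_r1 * 'Z_r2 | (nat_of_ord i.1 < m)%N && (i.2 == 0)].

Definition CRT_set (m n r1 r2 : nat) alpha (phi : 'Z_n -> 'Z_r1 * 'Z_r2) :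
    {set K} :=
  0 |: [set alpha ^+ (nat_of_ord i) | i in phi @^-1: Gamma m r1 r2].

End FieldCodes.

Definition is_order_mod (r a k : nat) : Prop :=
  [/\ (0 < k)%N, a ^ k = 1 %[mod r]
    & forall j, (0 < j)%N -> a ^ j = 1 %[mod r] -> (k <= j)%N].

Definition is_max (S : nat -> Prop) (k : nat) : Prop :=
  S k /\ forall j, S j -> (j <= k)%N.

(* Main.v *)
(* R(1,m) consists of the words y |-> b + Tr(a y): interpolate the word by a
   polynomial in y; its coefficients are power sums, the ones of the defining
   set vanish, and the remaining ones are conjugates of a single power sum.
   Hence a codeword is determined by its values at 0 and at 1, beta, ...,
   beta^(m-1), where beta is the primitive r1-th root of unity attached to
   (1,0): as Ord_r1(2) = m, these powers are independent over F_2, and counting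
   the pairs (a, b) shows that I is an information set.

   For the decoder, a translation first makes position 0 error free. As
   s < (lambda0 + 1) r2, one of the r2 fibers of Z_r1 x Z_r2 carries at most
   lambda0 errors, and since m lambda0 < r1 it contains a cyclic window of m
   consecutive error-free positions; a power of T_alpha moves that window onto
   I. Conversely any pair passing the syndrome test has no error on I. *)
Require Import Defs.
From HB Require Import structures.
From mathcomp Require Import all_boot all_order all_algebra all_fingroup.
From mathcomp Require Import finfield zify ring.
Set Implicit Arguments.
Unset Strict Implicit.
Unset Printing Implicit Defensive.
Import Order.TTheory GRing.Theory Num.Theory.
Local Open Scope ring_scope.

(** * Words and decoding with an information set *)

Lemma F2_cases (a : 'F_2) : a = 0 \/ a = 1.
Proof. by case: a => [[|[|k]] i]; [left; apply: val_inj | right; apply: val_inj | ]. Qed.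

Lemma wordP (T : finType) (x y : word T) : (forall g, entry x g = entry y g) -> x = y.
Proof.
by move=> exy; apply/rowP => j; have := exy (enum_val j); rewrite /entry enum_valK.
Qed.

Lemma entry_row (T : finType) (f : T -> 'F_2) g : entry (\row_j f (enum_val j)) g = f g.
Proof. by rewrite /entry mxE enum_rankK. Qed.

Lemma entryZ (T : finType) a (x : word T) g : entry (a *: x) g = a * entry x g.
Proof. by rewrite /entry mxE. Qed.

Lemma entryD (T : finType) (x y : word T) g : entry (x + y) g = entry x g + entry y g.
Proof. by rewrite /entry mxE. Qed.

Section WordLemmas.
Variable T : finType.
Implicit Types (x y c e : word T) (C : {set word T}) (I A : {set T}).
Implicit Types (tau sigma : {perm T}).

Lemma entryB x y g : entry (x - y) g = entry x g - entry y g.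
Proof. by rewrite /entry !mxE. Qed.

Lemma entry_permute tau x g : entry (permute tau x) g = entry x ((tau^-1)%g g).
Proof. exact: (entry_row (fun h => entry x ((tau^-1)%g h))). Qed.

Lemma entry_restrict A x (i : positions A) :
  entry (restrict A x) i = entry x (val i).
Proof. exact: (entry_row (fun h : positions A => entry x (val h))). Qed.

Lemma restrict_eqP A x y :
  reflect {in A, entry x =1 entry y} (restrict A x == restrict A y).
Proof.
apply: (iffP eqP) => [exy g Ag | exy].
  have := congr1 (fun z => entry z (Sub g Ag : positions A)) exy.
  by rewrite !entry_restrict.
by apply: wordP => g; rewrite !entry_restrict; apply/exy/(valP g).
Qed.

Lemma permuteD tau x y : permute tau (x + y) = permute tau x + permute tau y.
Proof. by apply: wordP => g; rewrite entryD !entry_permute entryD. Qed.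

Lemma permuteK tau : cancel (permute tau) (permute (tau^-1)%g).
Proof. by move=> x; apply: wordP => g; rewrite !entry_permute invgK permK. Qed.

Lemma permute1 x : permute 1%g x = x.
Proof. by apply: wordP => g; rewrite entry_permute invg1 perm1. Qed.

Lemma wgt_word x : wgt x = #|[set g | entry x g != 0]|.
Proof.
rewrite /wgt -(card_imset (mem [set g | entry x g != 0])
  (f := fun g => (ord0 : 'I_1, enum_rank g))); last first.
  by move=> g h [/enum_rank_inj].
apply: eq_card => -[i j]; rewrite ord1 inE /=.
apply/idP/imsetP => [nz | [g]].
  by exists (enum_val j); rewrite ?inE /entry ?enum_valK.
by rewrite inE => nz [->].
Qed.

Lemma wgt_col q (v : 'cV['F_2]_q) : wgt v = #|[set i | v i 0 != 0]|.
Proof.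
rewrite /wgt -(card_imset (mem [set i | v i 0 != 0])
  (f := fun i => (i, ord0 : 'I_1))); last by move=> g h [].
apply: eq_card => -[i j]; rewrite ord1 inE /=.
apply/idP/imsetP => [nz | [g]]; first by exists i; rewrite ?inE.
by rewrite inE => nz [->].
Qed.

Lemma wgt_permute tau x : wgt (permute tau x) = wgt x.
Proof.
rewrite !wgt_word -[RHS](card_imset _ (@perm_inj _ tau)); apply: eq_card => g.
rewrite inE entry_permute; apply/idP/imsetP => [nz | [h]].
  by exists ((tau^-1)%g g); rewrite ?inE ?permKV.
by rewrite inE => nz ->; rewrite permK.
Qed.

Lemma wgtB x y : (wgt (x - y) <= wgt x + wgt y)%N.
Proof.
rewrite !wgt_word -cardsUI; apply: leq_trans (leq_addr _ _).
apply/subset_leq_card/subsetP => g; rewrite !inE entryB.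
by apply: contraR; rewrite negb_or !negbK => /andP[/eqP-> /eqP->]; rewrite subr0.
Qed.

Lemma mindist_le C x y : x \in C -> y \in C -> x != y -> (mindist C <= wgt (x - y))%N.
Proof.
move=> Cx Cy xy; rewrite /mindist; have := mem_index_enum (x, y).
elim: index_enum => //= p s IHs; rewrite inE big_cons => /predU1P[<- | /IHs le_s].
  by rewrite /= Cx Cy xy geq_minl.
by case: ifP => // _; apply: leq_trans (geq_minr _ _) le_s.
Qed.

Lemma wgt0 x : (wgt x == 0)%N -> x = 0.
Proof.
rewrite wgt_word cards_eq0 => /eqP s0; apply: wordP => g.
have : g \notin [set g | entry x g != 0] by rewrite s0 inE.
by rewrite inE negbK => /eqP->; rewrite /entry mxE.
Qed.

(** The minimum also ranges over its default value [#|T|], which is positive only for a nonempty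
    [T]. *)
Lemma mindist_gt0 C : (0 < #|T|)%N -> (0 < mindist C)%N.
Proof.
move=> T0; rewrite /mindist; elim/big_ind: _ => //.
  by move=> a b a0 b0; rewrite leq_min a0.
move=> [x y] /= /and3P[_ _]; rewrite lt0n; apply: contra => /wgt0/eqP.
by rewrite subr_eq0.
Qed.

Lemma mindist_le_length C : (mindist C <= #|T|)%N.
Proof.
rewrite /mindist; elim/big_rec: _ => // p k _ le_k.
by rewrite geq_min le_k orbT.
Qed.

(** The strict bound 2t < d makes a codeword of weight at most 2t vanish; it would fail for d = 0,
    hence the appeal to positivity. *)
Lemma capability2 C : (0 < #|T|)%N -> (capability C + capability C < mindist C)%N.
Proof. by move/(mindist_gt0 C); rewrite /capability; lia. Qed.

Lemma capability_lt C : (0 < #|T|)%N -> (capability C < #|T|)%N.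
Proof.
by move=> T0; have := capability2 C T0; have := mindist_le_length C; lia.
Qed.

Lemma in_PAut C tau :
  (forall x, x \in C -> permute tau x \in C) -> tau \in PAut C.
Proof.
move=> stab; rewrite inE eqEcard card_imset; last exact: can_inj (permuteK tau).
by rewrite leqnn andbT; apply/subsetP => _ /imsetP[x Cx ->]; apply: stab.
Qed.

Lemma PAut_stable C tau x : tau \in PAut C -> x \in C -> permute tau x \in C.
Proof. by rewrite inE => /eqP stab Cx; rewrite -stab imset_f. Qed.

Lemma parity_check_orthogonal C (H : 'M_(#|T| - dimension C, #|T|)) x :
  parity_check_matrix C H -> x \in C -> H *m x^T = 0.
Proof.
move=> /span_basis spanH Cx; apply/row_matrixP => i; rewrite row_mul row0.
have : row i H \in <<enum (dual C)>>%VS.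
  by rewrite -spanH memv_span //; apply/mapP; exists i; rewrite ?mem_enum.
move/coord_span->; rewrite mulmx_suml big1 // => j _.
rewrite -scalemxAl; have : (enum (dual C))`_j \in dual C.
  by rewrite -mem_enum mem_nth // -cardE.
by rewrite inE => /forall_inP /(_ x Cx) /eqP ->; rewrite scaler0.
Qed.

(** * Syndromes for a parity check matrix in standard form *)

Section StandardForm.
Variables (I : {set T}) (q : nat) (H : 'M['F_2]_(q, #|T|)).
Hypothesis stdH : standard_form I H.

(** The columns of [H] off [I] form an identity matrix, so placing [z i] at position [f i] realises
    [z]; injectivity of [f] leaves at most one term in each inner sum. *)
Lemma standard_form_syndrome (z : 'cV['F_2]_q) :
  exists2 x, {in I, forall g, entry x g = 0} & H *m x^T = z.
Proof.
case: stdH => f [inj_f im_f Hf].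
exists (\row_j \sum_(i | f i == enum_val j) z i 0).
  move=> g Ig; rewrite (entry_row (fun g => \sum_(i | f i == g) z i 0)).
  rewrite big1 // => i /eqP fi.
  have : f i \in f @: [set: 'I_q] by rewrite imset_f.
  by rewrite im_f inE fi Ig.
apply/colP => i; rewrite mxE.
transitivity (\sum_k (1%:M : 'M['F_2]_q) i k * z k 0); last first.
  rewrite (bigD1 i) //= big1 ?addr0 => [|k ki]; rewrite mxE ?eqxx ?mulr1n ?mul1r //.
  by rewrite eq_sym (negPf ki) mulr0n mul0r.
rewrite -Hf; under eq_bigr do rewrite !mxE mulr_sumr.
rewrite (exchange_big_dep predT) //=; apply: eq_bigr => k _.
rewrite (big_pred1 (enum_rank (f k))) ?mxE // => j.
by rewrite pred1E -(inj_eq enum_val_inj) enum_rankK eq_sym.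
Qed.

(** Only identity columns meet the support of [x], so its syndrome merely lists its entries off [I].
    This makes syndrome weights comparable with error weights. *)
Lemma standard_form_entry x : {in I, forall g, entry x g = 0} ->
  exists2 f : 'I_q -> T, injective f /\ f @: [set: 'I_q] = ~: I
    & forall i, (H *m x^T) i 0 = entry x (f i).
Proof.
move=> x0; case: stdH => f [inj_f im_f Hf]; exists f => // i.
rewrite mxE; transitivity (\sum_k (1%:M : 'M['F_2]_q) i k * entry x (f k)); last first.
  rewrite (bigD1 i) //= big1 ?addr0 => [|k ki]; rewrite mxE ?eqxx ?mulr1n ?mul1r //.
  by rewrite eq_sym (negPf ki) mulr0n mul0r.
rewrite (reindex _ (onW_bij _ (@enum_rank_bij T))) /=.
rewrite (bigID (mem I)) /= big1 ?add0r => [|g Ig]; last first.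
  by rewrite mxE -/(entry x g) x0 ?mulr0.
rewrite (eq_bigl (fun g => g \in f @: [set: 'I_q])); last by move=> g; rewrite im_f inE.
rewrite big_imset /=; last by move=> ? ? _ _; apply: inj_f.
rewrite (eq_bigl predT); last by move=> k; rewrite inE.
by rewrite -Hf; apply: eq_bigr => k _; rewrite !mxE.
Qed.

Lemma wgt_syndrome x : {in I, forall g, entry x g = 0} -> wgt (H *m x^T) = wgt x.
Proof.
move=> x0; have [f [inj_f im_f] Hx] := standard_form_entry x0.
rewrite wgt_col wgt_word -(card_imset _ inj_f); apply: eq_card => g; rewrite inE.
apply/imsetP/idP => [[i + ->]|]; first by rewrite inE Hx.
move=> nz; have : g \in f @: [set: 'I_q].
  by rewrite im_f inE; apply: contra nz => /x0->.
by case/imsetP => i _ gE; exists i; rewrite // inE Hx -gE.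
Qed.

Lemma syndrome_eq0 x : {in I, forall g, entry x g = 0} -> H *m x^T = 0 -> x = 0.
Proof.
move=> x0 Hx; apply/wgt0; rewrite -(wgt_syndrome x0) Hx wgt_col cards_eq0.
by apply/eqP/setP => i; rewrite !inE mxE eqxx.
Qed.

End StandardForm.

(** * Decoding from an error-free information set *)

Section Decoding.
Variables (C : {set word T}) (I : {set T}) (q : nat) (H : 'M['F_2]_(q, #|T|)).
Hypothesis CB : forall x y, x \in C -> y \in C -> x - y \in C.
Hypothesis C_onto_I : restrict I @: C = [set: word (positions I)].
Hypothesis HC : forall x, x \in C -> H *m x^T = 0.
Hypothesis stdH : standard_form I H.

Lemma eq_on_information_set x y :
  x \in C -> y \in C -> restrict I x = restrict I y -> x = y.
Proof.
move=> Cx Cy /eqP/restrict_eqP exy; apply/eqP; rewrite -subr_eq0; apply/eqP.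
apply: (syndrome_eq0 stdH) => [g Ig|]; last exact/HC/CB.
by rewrite entryB exy // subrr.
Qed.

(** Subtracting the codeword that agrees with [x] on [I] leaves a word that vanishes on [I] and has
    syndrome zero, hence is zero. No double dual is needed. *)
Lemma syndrome_eq0_in_code x : H *m x^T = 0 -> x \in C.
Proof.
move=> Hx; have : restrict I x \in restrict I @: C by rewrite C_onto_I inE.
case/imsetP => c Cc /eqP/restrict_eqP exc; suff /eqP : x - c = 0.
  by rewrite subr_eq0 => /eqP ->.
apply: (syndrome_eq0 stdH) => [g Ig|]; first by rewrite entryB exc // subrr.
by rewrite linearB /= mulmxBr Hx HC // subr0.
Qed.

(* The syndrome of e is also that of a word f supported off I; both e and f
   have weight at most t, so e - f is a codeword of weight less than d. *)
Lemma low_syndrome_off_information_set c e : (0 < #|T|)%N ->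
  c \in C -> (wgt e <= capability C)%N ->
  (wgt (H *m (c + e)^T) <= capability C)%N -> {in I, forall g, entry e g = 0}.
Proof.
move=> T0 Cc we; rewrite linearD /= mulmxDr HC // add0r => wHe.
have [f f0 Hf] := standard_form_syndrome stdH (H *m e^T).
have Cef : e - f \in C.
  by apply: syndrome_eq0_in_code; rewrite linearB /= mulmxBr Hf subrr.
suff /eqP -> : e == f by [].
apply: contraLR wHe => ef; rewrite -ltnNge -Hf (wgt_syndrome stdH f0).
have C0 : (0 : word T) \in C by rewrite -(subrr c) CB.
have := mindist_le Cef C0; rewrite subr_eq0 => /(_ ef).
have := capability2 C T0; have := wgtB e f; rewrite subr0; lia.
Qed.

Lemma pick_codeword c e : c \in C -> {in I, forall g, entry e g = 0} ->
  [pick c' in C | restrict I c' == restrict I (c + e)] = Some c.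
Proof.
move=> Cc e0; have rce : restrict I (c + e) = restrict I c.
  by apply/eqP/restrict_eqP => g Ig; rewrite entryD e0 // addr0.
case: pickP => [c' /andP[Cc' /eqP] | /(_ c)]; rewrite rce.
  by move/(eq_on_information_set Cc' Cc) ->.
by rewrite Cc eqxx.
Qed.

End Decoding.

(** Restriction to [I] is a linear isomorphism from the code onto the space of all words on [I], so
    rank-nullity gives the dimension. *)
Lemma dimension_information_set C I : (forall x y, x \in C -> y \in C -> x - y \in C) ->
  (0 : word T) \in C ->
  {in C &, injective (restrict I)} -> restrict I @: C = [set: word (positions I)] ->
  dimension C = #|I|.
Proof.
move=> CB C0 inj_I onto_I.
have CD x y : x \in C -> y \in C -> x + y \in C.
  by move=> Cx Cy; rewrite -[y]opprK CB // -sub0r CB.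
have CZ (a : 'F_2) x : x \in C -> a *: x \in C.
  by case: (F2_cases a) => ->; rewrite ?scale0r ?scale1r.
(* [dimension] refers to the span; closure under differences and the scalars 0 and 1 identifies it
   with the code. *)
have spanC x : (x \in <<enum C>>%VS) = (x \in C).
  apply/idP/idP => [/coord_span -> | Cx]; last by rewrite memv_span ?mem_enum.
  elim/big_ind: _ => // i _; apply: CZ.
  by rewrite -mem_enum mem_nth // -cardE.
have lin : linear (restrict I).
  move=> a x y; apply: wordP => g.
  by rewrite !(entryD, entryZ, entry_restrict).
pose rI := GRing.isLinear.Build _ _ _ _ (restrict I) lin.
pose r : {linear word T -> word (positions I)} := HB.pack (restrict I) rI.
have ker0 : (<<enum C>> :&: lker (linfun r) = 0)%VS.
  apply/eqP; rewrite -subv0; apply/subvP => x; rewrite memv_cap spanC memv_ker lfunE /=.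
  case/andP=> Cx /eqP rx; rewrite memv0; apply/eqP; apply: inj_I => //.
  by rewrite rx; apply: esym; exact: (linear0 r).
have im : (linfun r @: <<enum C>> = fullv)%VS.
  apply/eqP; rewrite eqEsubv subvf; apply/subvP => y _.
  have : y \in restrict I @: C by rewrite onto_I inE.
  by case/imsetP=> x Cx ->; rewrite -[restrict I x](lfunE r) memv_img ?spanC.
rewrite /dimension -(limg_dim_eq ker0) im dimvf dim_matrix mul1r.
exact: card_sig.
Qed.

End WordLemmas.

(** * Binary weights *)

Lemma expn2_ord m (j : 'I_m) : (2 ^ j <= 2 ^ m.-1)%N.
Proof. by rewrite leq_exp2l //; have := ltn_ord j; lia. Qed.

(** The number of bits read does not matter once it covers [i]: the further bits vanish. *)
Lemma binary_weightE m i : (i < 2 ^ m)%N ->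
  binary_weight i = (\sum_(j < m) odd (i %/ 2 ^ j))%N.
Proof.
have pad p q : (p <= q)%N -> (i < 2 ^ p)%N ->
    (\sum_(j < q) odd (i %/ 2 ^ j) = \sum_(j < p) odd (i %/ 2 ^ j))%N.
  move=> le_pq lt_i; rewrite -!(big_mkord xpredT (fun j => odd (i %/ 2 ^ j) : nat)).
  rewrite (big_cat_nat (leq0n p) le_pq) //= -[RHS]addn0.
  congr addn; rewrite big_nat_cond big1 // => j /andP[/andP[le_pj _] _]; rewrite divn_small //.
  by apply: leq_trans lt_i _; rewrite leq_exp2l.
move=> lt_i; case: (leqP i m) => [le_im | /ltnW le_mi].
  by rewrite (pad i m) // ltn_expl.
by rewrite -(pad m i).
Qed.

Lemma binary_sum_rec m i :
  (\sum_(j < m.+1) odd (i %/ 2 ^ j) = odd i + \sum_(j < m) odd (i./2 %/ 2 ^ j))%N.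
Proof.
rewrite big_ord_recl expn0 divn1; congr addn; apply: eq_bigr => j _.
by rewrite /= /bump /= expnS -divn2 divnMA.
Qed.

(** Induction on the lowest bit. Among [m]-bit numbers, all ones means 2^m - 1, and a single zero at
    place j means 2^m - 1 - 2^j. *)
Lemma binary_sum_near_full m i : (i < 2 ^ m)%N ->
  [/\ (\sum_(j < m) odd (i %/ 2 ^ j) <= m)%N,
      (\sum_(j < m) odd (i %/ 2 ^ j))%N = m -> i.+1 = (2 ^ m)%N
    & ((\sum_(j < m) odd (i %/ 2 ^ j)).+1 = m)%N ->
      exists j : 'I_m, (i + 2 ^ j).+1 = (2 ^ m)%N].
Proof.
elim: m i => [|m IHm] i; first by rewrite big_ord0 expn0; split=> //; lia.
rewrite binary_sum_rec expnS => lt_i.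
have def_i : i = (odd i + i./2.*2)%N by rewrite odd_double_half.
have [|le_m eq_m eq_m1] := IHm i./2; first by move: lt_i def_i; lia.
move: (\sum_(j < m) _)%N le_m eq_m eq_m1 => S le_m eq_m eq_m1.
case: (odd i) def_i => /= def_i; split; try by lia.
- move=> E; have [j hj] := eq_m1 ltac:(lia); exists (lift ord0 j) => /=.
  by rewrite /bump /= expnS; lia.
- move=> E; have := eq_m ltac:(lia) => hi; exists ord0.
  by rewrite expn0; lia.
Qed.

(** This identifies the exponents below n that are missing from the defining set: they are the
    numbers n - 2^j. *)
Lemma binary_weight_large m i : (i < 2 ^ m - 1)%N -> (m - 1 <= binary_weight i)%N ->
  exists j : 'I_m, (i + 2 ^ j)%N = (2 ^ m - 1)%N.
Proof.
move=> lt_i; rewrite (@binary_weightE m); last by lia.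
have [|le_m eq_m eq_m1] := @binary_sum_near_full m i; first by lia.
move=> ge_m; have [E | E] :
  ((\sum_(j < m) odd (i %/ 2 ^ j))%N = m \/ (\sum_(j < m) odd (i %/ 2 ^ j)).+1 = m)%N by lia.
  by have := eq_m E; lia.
by have [j hj] := eq_m1 E; exists j; lia.
Qed.

Lemma binary_sum_full m : (\sum_(j < m) odd ((2 ^ m).-1 %/ 2 ^ j))%N = m.
Proof.
elim: m => [|m IHm]; first by rewrite big_ord0.
rewrite binary_sum_rec; have -> : (2 ^ m.+1).-1./2 = (2 ^ m).-1.
  by rewrite expnS; have := expn_gt0 2 m; lia.
have -> : odd (2 ^ m.+1).-1 by rewrite expnS; have := expn_gt0 2 m; lia.
by rewrite IHm.
Qed.

(** Induction on [m]: for j > 0 the number is odd and halving lowers j; for j = 0 its half consists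
    of ones only. *)
Lemma binary_weight_complement m i (j : 'I_m) :
  (i + 2 ^ j)%N = (2 ^ m - 1)%N -> (m - 1 <= binary_weight i)%N.
Proof.
move=> E; rewrite (@binary_weightE m); last by have := expn_gt0 2 j; have := expn_gt0 2 m; lia.
elim: m i j E => [|m IHm] i j; first by case: j.
case: (unliftP ord0 j) => [k -> | ->] E.
  move: k E => /= k E; rewrite binary_sum_rec /=; have := IHm i./2 k.
  have E' : (i + 2 * 2 ^ k = 2 * 2 ^ m - 1)%N by rewrite -!expnS.
  have m0 := expn_gt0 2 m; have -> : odd i by lia.
  move: (\sum_(_ < m) _)%N => S H; have := H ltac:(lia); have := ltn_ord k.
  by rewrite /=; lia.
rewrite expn0 in E; rewrite binary_sum_rec.
have -> : i./2 = (2 ^ m).-1 by move: E; rewrite expnS; have := expn_gt0 2 m; lia.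
by rewrite binary_sum_full; lia.
Qed.

(** * First-order Reed-Muller codes as trace codes *)

Definition bit (R : pzRingType) (a : 'F_2) : R := (nat_of_ord a)%:R.

Section FieldLemmas.
Variables (K : finFieldType) (m : nat).
Hypotheses (m_gt1 : (1 < m)%N) (cardK : #|K| = (2 ^ m)%N).

Local Notation bit := (bit K).

Lemma pchar2 : 2%N \in [pchar K].
Proof. exact: card_finPcharP cardK _. Qed.

Lemma bitD : {morph bit : a b / a + b}.
Proof.
move=> a b; case: (F2_cases a) => ->; case: (F2_cases b) => ->.
- by rewrite addr0 /bit addr0.
- by rewrite add0r /bit add0r.
- by rewrite addr0 /bit addr0.
by rewrite /bit /= (addrr_pchar2 pchar2).
Qed.

Lemma bitB : {morph bit : a b / a - b}.
Proof. by move=> a b; apply: (addIr (bit b)); rewrite -bitD !subrK. Qed.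

Lemma bit_inj : injective bit.
Proof.
move=> a b; case: (F2_cases a) => ->; case: (F2_cases b) => -> //.
  by move/esym/eqP; rewrite /bit /= oner_eq0.
by move/eqP; rewrite /bit /= oner_eq0.
Qed.

Lemma bit_onto (z : K) : z ^+ 2 = z -> exists a, bit a = z.
Proof.
move/eqP; rewrite -subr_eq0 expr2 -[X in _ - X]mulr1 -mulrBr mulf_eq0 subr_eq0.
by case/orP => /eqP->; [exists 0 | exists 1].
Qed.

Lemma bitX a k : (0 < k)%N -> bit a ^+ k = bit a.
Proof.
by case: k => // k _; case: (F2_cases a) => ->; rewrite /bit /= ?expr1n // expr0n.
Qed.

Lemma Frobenius_iterD j (x y : K) : (x + y) ^+ (2 ^ j) = x ^+ (2 ^ j) + y ^+ (2 ^ j).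
Proof.
by apply: exprDn_pchar; rewrite pnatX pnatE // pchar2.
Qed.

Lemma Frobenius_iter0 j : 0 ^+ (2 ^ j) = 0 :> K.
Proof. by rewrite expr0n expn_eq0. Qed.

(** The absolute trace to F_2, with its values kept in [K]. *)
Definition trace (z : K) : K := \sum_(j < m) z ^+ (2 ^ j).

Lemma traceD : {morph trace : x y / x + y}.
Proof.
move=> x y; rewrite /trace -big_split; apply: eq_bigr => j _.
exact: Frobenius_iterD.
Qed.

Lemma trace0 : trace 0 = 0.
Proof. by rewrite /trace big1 // => j _; rewrite expr0n expn_eq0. Qed.

(** Squaring permutes the [m] conjugates cyclically because z^(2^m) = z. Hence the trace is 0 or
    1. *)
Lemma trace_idem z : trace z ^+ 2 = trace z.
Proof.
have shift : forall F : nat -> K, F m = F 0%N -> \sum_(j < m) F j.+1 = \sum_(j < m) F j.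
  move=> F Fm; apply: (addrI (F 0%N)).
  transitivity (\sum_(j < m.+1) F j); first by rewrite big_ord_recl.
  by rewrite big_ord_recr /= Fm addrC.
rewrite /trace (big_morph (fun x : K => x ^+ (2 ^ 1)) (Frobenius_iterD 1) (Frobenius_iter0 1)).
rewrite -[RHS](shift (fun j => z ^+ (2 ^ j))); last by rewrite -cardK expf_card expr1.
by apply: eq_bigr => j _; rewrite -exprM -expnD addn1.
Qed.

(** For nonzero [a] the trace would vanish on all of [K], but it is a nonzero polynomial of degree
    at most 2^(m-1), too small for 2^m roots. *)
Lemma trace_nondegenerate a : (forall y, trace (a * y) = 0) -> a = 0.
Proof.
move=> tr0; apply/eqP; apply: contraT => a0.
pose p : {poly K} := \sum_(j < m) 'X^(2 ^ j).
have pE z : p.[z] = trace z.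
  by rewrite /p /trace horner_sum; apply: eq_bigr => j _; rewrite hornerXn.
have p_small : (size p <= (2 ^ m.-1).+1)%N.
  apply: leq_trans (size_sum _ _ _) _; apply/bigmax_leqP => j _.
  by rewrite size_polyXn ltnS expn2_ord.
(* The coefficient of X is 1, since 2^j = 1 only for j = 0. *)
have p_nz : p != 0.
  apply/eqP => /(congr1 (fun p : {poly K} => p`_1)); rewrite coef0 coef_sum.
  rewrite (bigD1 (Ordinal (ltnW m_gt1))) //= coefXn expn0 big1 ?addr0.
    by move/eqP; rewrite oner_eq0.
  move=> j j0; rewrite coefXn; case: eqP => // /esym/eqP.
  by rewrite -[1%N](expn0 2) eqn_exp2l // => j0'; rewrite -val_eqE /= j0' in j0.
have p_roots : all (root p) (enum K).
  apply/allP => z _; rewrite rootE pE; apply/eqP.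
  by have := tr0 (a^-1 * z); rewrite mulVKf.
have := max_poly_roots p_nz p_roots (enum_uniq K); rewrite -cardE cardK => lt_q.
have := leq_trans lt_q p_small; rewrite ltnS leq_exp2l //; lia.
Qed.

(* A nonzero polynomial over F_2 of degree less than m vanishing at beta would
   also vanish at the m distinct conjugates beta ^ (2 ^ j). *)
Lemma primitive_powers_span r (beta : K) : is_order_mod r 2 m ->
  r.-primitive_root beta ->
  forall y, exists u : 'I_m -> 'F_2, y = \sum_i bit (u i) * beta ^+ i.
Proof.
case=> _ ord_m min_m beta_prim.
(* [r] divides the odd number 2^m - 1. *)
have co : coprime r 2.
  rewrite coprimen2; apply: (@dvdn_odd _ (2 ^ m - 1)%N).
    by rewrite -eqn_mod_dvd ?expn_gt0 //; apply/eqP.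
  by rewrite oddB ?expn_gt0 // oddX; case: m m_gt1.
(* Domain and codomain both have 2^m elements, so independence of the powers already gives
   spanning. *)
pose ev (u : {ffun 'I_m -> 'F_2}) := \sum_i bit (u i) * beta ^+ i.
suff inj_ev : injective ev.
  move=> y; have : y \in codom ev.
    by apply: inj_card_onto inj_ev _ _; rewrite cardK card_ffun card_Fp // card_ord.
  by case/codomP => u ->; exists u.
move=> u v E; pose w (i : 'I_m) := bit (u i) - bit (v i).
pose p : {poly K} := \poly_(i < m) oapp w 0 (insub i).
have pE z : p.[z] = \sum_i w i * z ^+ i.
  by rewrite horner_poly; apply: eq_bigr => i _; rewrite valK.
have wX i j : w i ^+ (2 ^ j) = w i by rewrite /w -bitB bitX ?expn_gt0.
have p_beta : p.[beta] = 0.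
  rewrite pE; under eq_bigr do rewrite mulrBl.
  by rewrite sumrB; apply/eqP; rewrite subr_eq0; apply/eqP.
have p_roots : all (root p) [seq beta ^+ (2 ^ j) | j <- iota 0 m].
  apply/allP => _ /mapP[j _ ->]; rewrite rootE pE.
  have := congr1 (fun x : K => x ^+ (2 ^ j)) p_beta; rewrite pE /=.
  rewrite (big_morph _ (Frobenius_iterD j) (Frobenius_iter0 j)) Frobenius_iter0 => {2}<-.
  by apply/eqP/eq_bigr => i _; rewrite exprMn wX exprAC.
have p_uniq : uniq [seq beta ^+ (2 ^ j) | j <- iota 0 m].
  rewrite map_inj_in_uniq ?iota_uniq // => i j.
  rewrite !mem_iota !add0n /= => lt_i lt_j /eqP.
  wlog le_ij : i j lt_i lt_j / (i <= j)%N.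
    by move=> W; case/orP: (leq_total i j) => le /eqP E'; [|symmetry]; apply: W => //; apply/eqP.
  rewrite (eq_prim_root_expr beta_prim) eq_sym eqn_mod_dvd ?leq_exp2l //.
  (* Equal conjugates give r | 2^i (2^(j-i) - 1); the odd [r] then divides the second factor,
     against the minimality of [m] unless i = j. *)
  rewrite -(subnK le_ij) expnD -{2}[(2 ^ i)%N]mul1n -mulnBl Gauss_dvdl ?coprimeXr //.
  rewrite -eqn_mod_dvd ?expn_gt0 // => /eqP E'.
  by have [|/min_m/(_ E')] := posnP (j - i); lia.
have p0 : p = 0.
  apply/eqP; apply: contraT => p_nz; have := max_poly_roots p_nz p_roots p_uniq.
  by rewrite size_map size_iota ltnNge size_poly.
apply/ffunP => i; apply: bit_inj; apply/eqP; rewrite -subr_eq0 -/(w i).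
have := congr1 (fun p : {poly K} => p`_i) p0.
by rewrite coef0 coef_poly ltn_ord valK /= => ->.
Qed.

Variable n : nat.
Hypothesis n_def : n = (2 ^ m - 1)%N.

Lemma pow2_n : (2 ^ m = n.+1)%N.
Proof. by rewrite n_def; have := expn_gt0 2 m; lia. Qed.

Lemma pow2_lt_n (j : 'I_m) : (2 ^ j < n)%N.
Proof.
have := expn2_ord j; have := pow2_n.
have : (1 < 2 ^ m.-1)%N by rewrite -{1}(expn0 2) ltn_exp2l //; lia.
have : (2 ^ m = 2 * 2 ^ m.-1)%N by rewrite -expnS (ltn_predK m_gt1).
by lia.
Qed.

Lemma expf_n (y : K) : y != 0 -> y ^+ n = 1.
Proof.
move=> y0; apply: (mulfI y0); rewrite -exprS mulr1 -pow2_n -cardK.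
exact: expf_card.
Qed.

Variable alpha : K.
Hypothesis alpha_prim : n.-primitive_root alpha.

Lemma nz_alpha (y : K) : y != 0 -> exists i, y = alpha ^+ i.
Proof. by move/expf_n/(prim_rootP alpha_prim) => [i ->]; exists i. Qed.

Lemma alpha_neq0 : alpha != 0.
Proof. by rewrite (prim_root_eq0 alpha_prim) -lt0n (prim_order_gt0 alpha_prim). Qed.

(** The substitution of [alpha * g] for g multiplies the sum by [alpha ^+ k], which differs from 1.
    For k = 0 the sum is 2^m = 0, with 0^0 = 1. *)
Lemma sum_powers k : (k == 0)%N || ~~ (n %| k)%N -> \sum_(g : K) g ^+ k = 0.
Proof.
case: k => [_ | k /= ndvd].
  rewrite (eq_bigr (fun=> 1)) // sumr_const cardK natrX pcharf0 ?pchar2 //.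
  by rewrite expr0n; case: m m_gt1.
have : alpha ^+ k.+1 - 1 != 0 by rewrite subr_eq0 -(prim_order_dvd alpha_prim).
apply: contraNeq => S0; apply/eqP/(mulIf S0); rewrite mul0r mulrBl mul1r.
rewrite [X in _ - X](reindex_inj (mulfI alpha_neq0)) mulr_sumr -sumrB big1 // => g _.
by rewrite exprMn subrr.
Qed.

(* Lagrange interpolation: sum_(i < q) y^(q-1-i) g^i = (y^q - g^q) / (y - g)
   equals 1 when y <> g, and q y^(q-1) = 0 when y = g. *)
Lemma bit_entry_expand (x : word K) y :
  bit (entry x y) =
    power_sum 0 x + \sum_(i < 2 ^ m) y ^+ (2 ^ m - 1 - i) * power_sum i x.
Proof.
rewrite /power_sum; under [X in _ + X]eq_bigr do rewrite mulr_sumr.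
(* The term at [y] gets its bit from [power_sum 0] alone; every other bit occurs twice and
   cancels. *)
rewrite exchange_big -big_split (bigD1 y) //= [X in _ = _ + X]big1 ?addr0 => [|g gy].
  rewrite expr0 mulr1 -[LHS]addr0; congr (_ + _).
  rewrite (eq_bigr (fun=> bit (entry x y) * y ^+ (2 ^ m - 1))) => [|i _]; last first.
    rewrite mulrCA -exprD; congr (_ * y ^+ _); have := ltn_ord i; lia.
  rewrite sumr_const card_ord -mulr_natr natrX pcharf0 ?pchar2 // expr0n.
  by case: m m_gt1 => // k _; rewrite mulr0.
have : y - g != 0 by rewrite subr_eq0 eq_sym.
move/mulfI; apply; rewrite mulr0 mulrDr mulr_sumr.
rewrite (eq_bigr (fun i : 'I_(2 ^ m) =>
  bit (entry x g) * ((y - g) * (y ^+ ((2 ^ m).-1 - i) * g ^+ i)))) => [|i _].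
  rewrite -mulr_sumr -mulr_sumr -subrXX -cardK !expf_card expr0 mulr1 mulrC -mulrDr.
  by rewrite (addrr_pchar2 pchar2) mulr0.
by rewrite subn1; rewrite /bit; ring.
Qed.

(** Frobenius fixes the bits, and 2^j (n - 1) is congruent to n - 2^j modulo n. At g = 0 both
    exponents are positive, so both sides vanish. *)
Lemma power_sum_Frobenius j (x : word K) : (j < m)%N ->
  power_sum (n - 2 ^ j) x = power_sum (n - 1) x ^+ (2 ^ j).
Proof.
move=> lt_j; have := pow2_lt_n (Ordinal lt_j) => /= lt_n.
rewrite /power_sum (big_morph (fun x : K => x ^+ (2 ^ j)) (Frobenius_iterD j) (Frobenius_iter0 j)).
apply: eq_bigr => g _; rewrite exprMn -/(bit _) bitX ?expn_gt0 //; congr (_ * _).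
have [-> | g0] := eqVneq g 0.
  have j0 := expn_gt0 2 j.
  have zX k : (0 < k)%N -> 0 ^+ k = 0 :> K by case: k => // k _; rewrite expr0n.
  by rewrite -exprM !zX // ?muln_gt0 ?subn_gt0 ?j0 ?lt_n ?(leq_ltn_trans j0 lt_n).
have gj0 : g ^+ (2 ^ j) != 0 by rewrite expf_neq0.
apply: (mulIf gj0); rewrite -exprD subnK ?(ltnW lt_n) // -exprMn -exprSr.
by rewrite subn1 prednK ?expf_n ?expr1n // (leq_trans _ lt_n).
Qed.

Lemma RM1P (x : word K) :
  reflect (exists a, forall y, bit (entry x y) = bit (entry x 0) + trace (a * y))
    (x \in RM1 K m).
Proof.
apply: (iffP idP) => [Cx | [a xE]].
  have ps0 i : (i < n)%N -> (binary_weight i < m - 1)%N -> power_sum i x = 0.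
    move=> lt_i lt_w; rewrite n_def in lt_i; move: Cx; rewrite inE.
    by move=> /forallP /(_ (Ordinal lt_i)) /= /implyP /(_ lt_w) /eqP.
  (* The surviving exponents are n, giving the constant term, and n - 2^j, giving the conjugates of
     this power sum. *)
  exists (power_sum (n - 1) x) => y.
  suff expand z : bit (entry x z) = power_sum n x + trace (power_sum (n - 1) x * z).
    by rewrite (expand 0) mulr0 trace0 addr0 expand.
  have n_gt0 := prim_order_gt0 alpha_prim.
  (* Since m > 1, exponent 0 lies in the defining set and the extra term disappears. *)
  rewrite bit_entry_expand ps0 // ?add0r; last first.
    by rewrite /binary_weight big_ord0 subn_gt0.
  rewrite -n_def pow2_n big_ord_recr /= subnn expr0 mul1r addrC; congr (_ + _).
  have lt_h (j : 'I_m) : (n - 2 ^ j < n)%N by have := pow2_lt_n j; have := expn_gt0 2 j; lia.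
  pose h j := Ordinal (lt_h j).
  rewrite (bigID (fun i => i \in h @: [set: 'I_m])) /= [X in _ + X]big1 ?addr0.
    rewrite big_imset /=; last first.
      move=> i j _ _ [] E; apply/val_inj/eqP; rewrite -(eqn_exp2l _ _ (ltnSn 1)).
      by rewrite /=; apply/eqP; have := pow2_lt_n i; have := pow2_lt_n j; lia.
    apply: eq_big => [j|j _]; first by rewrite inE.
    rewrite power_sum_Frobenius // exprMn mulrC; congr (_ * z ^+ _).
    by have := pow2_lt_n j; lia.
  move=> i i_notin; rewrite ps0 ?mulr0 // ltnNge; apply: contra i_notin => large.
  have [|j hj] := @binary_weight_large m i _ large; first by rewrite -n_def.
  by apply/imsetP; exists j; rewrite ?inE //; apply: val_inj; move: hj; rewrite -n_def /=; lia.
(* Conversely, the power sum of a trace word is a combination of sums of g^(2^j + i), each zero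
   unless n divides 2^j + i. *)
rewrite inE; apply/forallP => -[i /= lt_i]; apply/implyP => small; apply/eqP.
rewrite /power_sum; under eq_bigr do rewrite -/(bit _) xE mulrDl /trace mulr_suml.
rewrite big_split /= -mulr_sumr sum_powers ?mulr0 ?add0r; last first.
  by case: i lt_i {small} => //= i lt_i; apply/negP => /dvdn_leq; rewrite n_def; lia.
rewrite exchange_big big1 // => j _.
under eq_bigr do rewrite exprMn -mulrA -exprD.
rewrite -mulr_sumr sum_powers ?mulr0 //; have := expn_gt0 2 j => j0.
apply/orP; right; apply/negP => /dvdnP[k E]; have := pow2_lt_n j => lt_j.
(* As 0 < i + 2^j < 2n, the sum equals n, so [i] has weight at least m - 1 and is outside the
   defining set. *)
have k1 : k = 1%N by nia.
move: small; rewrite ltnNge => /negP; apply; apply: (@binary_weight_complement m i j).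
by rewrite -n_def; lia.
Qed.

End FieldLemmas.

(** * Automorphisms and information sets of the first-order Reed-Muller code *)

Section ReedMuller.
Variables (K : finFieldType) (m n : nat) (alpha : K).
Hypotheses (m_gt1 : (1 < m)%N) (cardK : #|K| = (2 ^ m)%N).
Hypotheses (n_def : n = (2 ^ m - 1)%N) (alpha_prim : n.-primitive_root alpha).

Local Notation bit := (bit K).
Local Notation trace := (@trace K m).
Local Notation C := (RM1 K m).

Let inC (x : word K) : reflect (exists a, forall y,
  bit (entry x y) = bit (entry x 0) + trace (a * y)) (x \in C).
Proof. exact: (RM1P m_gt1 cardK n_def alpha_prim). Qed.

Let traceN z : trace (- z) = - trace z.
Proof.
by apply: (addrI (trace z)); rewrite -(traceD cardK) !subrr trace0.
Qed.

Lemma RM1_sub (x y : word K) : x \in C -> y \in C -> x - y \in C.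
Proof.
move=> /inC[a xE] /inC[b yE]; apply/inC; exists (a - b) => z.
rewrite !entryB !(bitB cardK) xE yE mulrBl (traceD cardK) traceN; ring.
Qed.

Lemma RM1_0 : (0 : word K) \in C.
Proof.
by apply/inC; exists 0 => y; rewrite mul0r trace0 // addr0 /entry !mxE.
Qed.

Lemma translation_PAut a : translation a \in PAut C.
Proof.
apply: in_PAut => x /inC[b xE]; apply/inC; exists b => y.
have tE z : ((translation a)^-1)%g z = z - a.
  by apply: (@perm_inj _ (translation a)); rewrite permKV permE /= subrK.
rewrite !entry_permute !tE xE [in RHS]xE mulrBr (traceD cardK) sub0r mulrN.
by ring.
Qed.

Lemma homothety_PAut (tau : {perm K}) c : c != 0 -> (forall y, tau y = c * y) ->
  tau \in PAut C.
Proof.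
move=> c0 tauE; apply: in_PAut => x /inC[b xE]; apply/inC; exists (b / c) => y.
have tE z : (tau^-1)%g z = c^-1 * z.
  by apply: (@perm_inj _ tau); rewrite permKV tauE mulVKf.
by rewrite !entry_permute !tE mulr0 xE mulrA.
Qed.

Section InformationSet.
Variables (I : {set K}) (b : 'I_m -> K).
Hypotheses (card_I : #|I| = m.+1) (I0 : 0 \in I) (Ib : forall i, b i \in I).
Hypothesis b_span : forall y, exists u : 'I_m -> 'F_2, y = \sum_i bit (u i) * b i.

(** The difference of two codewords agreeing on [I] is a linear form, as its value at 0 vanishes; it
    is zero on the spanning family [b], hence everywhere. *)
Lemma RM1_restrict_inj : {in C &, injective (restrict I)}.
Proof.
move=> x y Cx Cy /eqP/restrict_eqP exy; apply/eqP; rewrite -subr_eq0; apply/eqP.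
have z0 g : g \in I -> entry (x - y) g = 0 by move=> Ig; rewrite entryB exy ?subrr.
have [a] := inC _ (RM1_sub Cx Cy); rewrite z0 // => zE.
apply: wordP => g; apply: (@bit_inj K); rewrite zE [in RHS]/entry mxE.
rewrite [X in X + _](_ : _ = 0) ?add0r //; have [u ->] := b_span g.
rewrite mulr_sumr (big_morph trace (traceD cardK) (trace0 _ _)) big1 // => i _.
case: (F2_cases (u i)) => ->; rewrite /bit /= ?mul0r ?mulr0 ?trace0 // mul1r.
by have := zE (b i); rewrite z0 // /bit /= add0r => <-.
Qed.

(** The 2^(m+1) pairs of slope and constant give words that stay distinct on [I], which has exactly
    2^(m+1) words; so restriction is onto. *)
Lemma RM1_information_set : information_set C I.
Proof.
suff onto_I : restrict I @: C = [set: word (positions I)].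
  split=> //; apply/esym/dimension_information_set => //.
  - exact: RM1_sub.
  - exact: RM1_0.
  exact: RM1_restrict_inj.
(* The trace is 0 or 1 in [K]; the test [!= 0] reads it as an element of F_2. *)
pose cw (p : K * 'F_2) : word K :=
  \row_j (p.2 + (trace (p.1 * enum_val j) != 0)%:R).
have cwE p y : bit (entry (cw p) y) = bit p.2 + trace (p.1 * y).
  rewrite (entry_row (fun y => p.2 + (trace (p.1 * y) != 0)%:R)) (bitD cardK).
  congr (_ + _); have [v <-] := bit_onto (trace_idem cardK (p.1 * y)).
  by case: (F2_cases v) => ->; rewrite /bit /= ?eqxx ?oner_eq0.
have cwC p : cw p \in C.
  by apply/inC; exists p.1 => y; rewrite !cwE mulr0 trace0 // addr0.
have inj : injective (restrict I \o cw).
  move=> [a u] [a' u'] /= /(RM1_restrict_inj (cwC _) (cwC _)) E.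
  have tr y : bit u + trace (a * y) = bit u' + trace (a' * y).
    by rewrite -(cwE (a, u)) -(cwE (a', u')) E.
  have uu' : u = u' by apply: (@bit_inj K); have := tr 0; rewrite !mulr0 trace0 // !addr0.
  congr pair => //; apply/eqP; rewrite -subr_eq0; apply/eqP.
  apply: (trace_nondegenerate m_gt1 cardK) => y.
  rewrite mulrBl (traceD cardK) traceN; have := tr y; rewrite uu' => /addrI->.
  exact: subrr.
apply/setP => z; rewrite inE; have : z \in codom (restrict I \o cw).
  apply: inj_card_onto inj _ _; rewrite card_mx card_prod cardK card_Fp // mul1n.
  by rewrite [#|positions I|]card_sig -expnSr leq_exp2l // -[X in (_ <= X)%N]card_I.
by case/codomP => p ->; apply/imsetP; exists (cw p).
Qed.

End InformationSet.

End ReedMuller.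

(** * The decoding algorithm *)

Lemma fixing0_PAut_punctured (K : finFieldType) (C : {set word K}) (tau : {perm K}) :
  tau 0 = 0 -> tau \in PAut C -> tau \in PAut_punctured C.
Proof.
move=> tau0 tauC; rewrite inE tau0 eqxx /=.
have tau_nz (g : positions [set~ (0 : K)]) : tau (val g) \in [set~ 0].
  have := valP g; rewrite !inE; apply: contra => /eqP E.
  by apply/eqP/(@perm_inj _ tau); rewrite tau0.
pose f (g : positions [set~ (0 : K)]) : positions [set~ 0] := Sub (tau (val g)) (tau_nz g).
have inj_f : injective f by move=> g h /(congr1 val) /= /perm_inj/val_inj.
apply/existsP; exists (perm inj_f); apply/andP; split; last first.
  by apply/forallP => g; rewrite permE.
apply: in_PAut => _ /imsetP[x Cx ->]; apply/imsetP.
exists (permute tau x); first exact: PAut_stable.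
apply: wordP => g; rewrite entry_permute !entry_restrict entry_permute.
congr entry; apply: (@perm_inj _ tau); rewrite permKV.
by rewrite -{2}[g](permKV (perm inj_f)) permE.
Qed.

(** * Error-free windows by counting *)

Section FreeWindow.
Variables (r1 r2 m lambda : nat).

(** Pigeonhole: [lambda + 1] points in each of the r2 fibers would exceed the bound on [B] by
    one. *)
Lemma sparse_fiber (B : {set 'Z_r1 * 'Z_r2}) : (1 < r2)%N ->
  (#|B| <= (lambda + 1) * r2 - 1)%N ->
  exists c, (#|[set a | (a, c) \in B]| <= lambda)%N.
Proof.
move=> r2_gt1 B_small.
suff /existsP[c Hc] : [exists c, #|[set a | (a, c) \in B]| <= lambda]%N by exists c.
apply: contraLR B_small; rewrite negb_exists -ltnNge => /forallP dense.
have -> : #|B| = (\sum_(c : 'Z_r2) #|[set a | (a, c) \in B]|)%N.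
  under eq_bigr do rewrite -sum1_card.
  rewrite (exchange_big_dep predT) //= -sum1_card.
  rewrite (eq_bigl (fun p => (p.1, p.2) \in B)); last by case.
  rewrite -(pair_big_dep xpredT (fun a c => (a, c) \in B) (fun _ _ => 1%N)) /=.
  by apply: eq_bigr => a _; apply: eq_bigl => c; rewrite inE.
have : (\sum_(c : 'Z_r2) (lambda + 1) <= \sum_(c : 'Z_r2) #|[set a | (a, c) \in B]|)%N.
  by apply: leq_sum => c _; have := dense c; rewrite -ltnNge addn1.
by rewrite sum_nat_const card_ord [X in (X * _)%N]Zp_cast // mulnC; lia.
Qed.

(* Each point of the sparse fiber spoils at most m of the r1 possible starting
   points of a window of m consecutive positions. *)
Lemma free_window (B : {set 'Z_r1 * 'Z_r2}) : (1 < r1)%N -> (1 < r2)%N ->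
  (lambda * m < r1)%N -> (#|B| <= (lambda + 1) * r2 - 1)%N ->
  exists u : 'Z_r1 * 'Z_r2, forall k : 'I_m, u + (k%:R, 0) \notin B.
Proof.
move=> r1_gt1 r2_gt1 lt_r1 /(sparse_fiber r2_gt1)[c sparse].
set F := [set a | (a, c) \in B] in sparse.
pose bad := [set p.1 - (p.2 : nat)%:R | p : 'Z_r1 * 'I_m in setX F setT].
have : (#|bad| < #|'Z_r1|)%N.
  apply: leq_ltn_trans (leq_imset_card _ _) _; rewrite cardsX cardsT !card_ord.
  rewrite [X in (_ < X)%N]Zp_cast //.
  by apply: leq_ltn_trans lt_r1; rewrite leq_mul2r sparse orbT.
rewrite -(cardsC bad) -[X in (X < _)%N]addn0 ltn_add2l => /card_gt0P[a].
rewrite inE => good; exists (a, c) => k; apply: contra good => Bk.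
apply/imsetP; exists (a + k%:R, k); rewrite ?inE /= ?addrK // andbT.
by move: Bk; rewrite /GRing.add /= /add_pair /= addr0.
Qed.

End FreeWindow.

(** * Nonzero field elements indexed by pairs of residues *)

Section CRTPowers.
Variables (K : finFieldType) (n r1 r2 m : nat) (alpha : K).
Variables (phi : 'Z_n -> 'Z_r1 * 'Z_r2) (psi : 'Z_r1 * 'Z_r2 -> 'Z_n).
Hypotheses (n_gt1 : (1 < n)%N) (r1_gt1 : (1 < r1)%N) (m_lt_r1 : (m < r1)%N).
Hypotheses (alpha_prim : n.-primitive_root alpha) (phiD : {morph phi : i j / i + j}).
Hypotheses (phiK : cancel phi psi) (psiK : cancel psi phi).

(** Turns addition of pairs into multiplication in [K], so that translating a window becomes
    applying a power of [Talpha]. *)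
Definition CRT_power (u : 'Z_r1 * 'Z_r2) : K := alpha ^+ (psi u : nat).

Lemma CRT_powerD u v : CRT_power (u + v) = CRT_power u * CRT_power v.
Proof.
rewrite /CRT_power; have -> : psi (u + v) = psi u + psi v.
  by apply: (can_inj phiK); rewrite phiD !psiK.
by rewrite -exprD /= [X in (_ %% X)%N]Zp_cast // (prim_expr_mod alpha_prim).
Qed.

Lemma CRT_power_inj : injective CRT_power.
Proof.
have lt_n (i : 'Z_n) : (i < n)%N by have := ltn_ord i; rewrite [X in (_ < X)%N]Zp_cast.
move=> u v /eqP; rewrite (eq_prim_root_expr alpha_prim) !modn_small //.
by move=> /eqP/val_inj/(can_inj psiK).
Qed.

Lemma CRT_power0 : CRT_power 0 = 1.
Proof.
have nz : CRT_power 0 != 0.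
  by rewrite expf_neq0 // (prim_root_eq0 alpha_prim) -lt0n ltnW.
by apply: (mulIf nz); rewrite -CRT_powerD addr0 mul1r.
Qed.

Lemma CRT_powerX k : CRT_power (k%:R, 0) = CRT_power (1, 0) ^+ k.
Proof.
elim: k => [|k IHk]; first by rewrite expr0 -CRT_power0.
rewrite exprSr -IHk -CRT_powerD; congr CRT_power.
by rewrite -natr1 -[in LHS](addr0 0).
Qed.

(** The k-th power is the image of (k, 0), which is trivial exactly when r1 divides k. *)
Lemma CRT_power_prim : r1.-primitive_root (CRT_power (1, 0)).
Proof.
have pow1 k : (CRT_power (1, 0) ^+ k == 1) = (r1 %| k)%N.
  rewrite -CRT_powerX -CRT_power0 (inj_eq CRT_power_inj) xpair_eqE eqxx andbT.
  by rewrite -val_eqE /= val_Zp_nat.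
have [|k k_prim k_dvd] := @prim_order_exists _ r1 (CRT_power (1, 0)) (ltnW r1_gt1).
  by apply/eqP; rewrite pow1.
suff kr : k = r1 by rewrite kr in k_prim.
by apply/eqP; rewrite eqn_dvd k_dvd -pow1 (prim_expr_order k_prim) eqxx.
Qed.

Lemma CRT_setE :
  CRT_set m alpha phi = 0 |: [set CRT_power (1, 0) ^+ (i : nat) | i : 'I_m].
Proof.
congr (_ |: _); apply/setP => y; apply/imsetP/imsetP => [[i] | [i _ ->]].
  rewrite inE; case E: (phi i) => [a c]; rewrite inE /= => /andP[lt_a /eqP c0] ->.
  exists (Ordinal lt_a) => //=; rewrite -CRT_powerX natr_Zp -c0 -E /CRT_power.
  by rewrite phiK.
exists (psi ((i : nat)%:R, 0)); last by rewrite -CRT_powerX.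
(* As i < m < r1, reduction modulo r1 leaves [i] unchanged. *)
rewrite !inE psiK /= eqxx andbT val_Zp_nat // modn_small //.
exact: ltn_trans m_lt_r1.
Qed.

Lemma card_CRT_set : #|CRT_set m alpha phi| = m.+1.
Proof.
rewrite CRT_setE cardsU1 card_imset ?card_ord; last first.
  move=> i j /eqP; rewrite (eq_prim_root_expr CRT_power_prim).
  by rewrite !modn_small ?(ltn_trans _ m_lt_r1) // => /eqP/val_inj.
suff -> : 0 \notin [set CRT_power (1, 0) ^+ (i : nat) | i : 'I_m] by [].
apply/imsetP => -[i _ /esym/eqP]; rewrite expf_eq0 (prim_root_eq0 CRT_power_prim).
by case/andP => _; rewrite -leqn0 leqNgt (ltnW r1_gt1).
Qed.

End CRTPowers.

(** * Correctness of the search *)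

Section Decoder.
Variables (K : finFieldType) (C : {set word K}) (I : {set K}) (alpha : K).
Variables (q : nat) (H : 'M['F_2]_(q, #|K|)) (P : seq {perm K}).
Hypothesis CB : forall x y, x \in C -> y \in C -> x - y \in C.
Hypothesis C_onto_I : restrict I @: C = [set: word (positions I)].
Hypothesis HC : forall x, x \in C -> H *m x^T = 0.
Hypothesis stdH : standard_form I H.
Hypothesis translations_PAut : forall a, translation a \in PAut C.
Hypothesis P_PAut : {subset P <= PAut C}.

(** One pair that clears [I] of errors guarantees that the search succeeds. It may stop at an
    earlier pair, but any pair passing the test also clears [I], so re-encoding recovers the
    permuted [c]. *)
Lemma algorithmII_correct c e : c \in C -> (wgt e <= capability C)%N ->
  (exists sigma tau, [/\ sigma \in Sigma alpha, tau \in P &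
     {in I, forall g, entry (permute tau (permute sigma e)) g = 0}]) ->
  algorithmII C alpha I H P (c + e) = Some c.
Proof.
move=> Cc we [sigma [tau [S_sigma P_tau off]]]; rewrite /algorithmII.
have K_gt0 : (0 < #|K|)%N by apply/card_gt0P; exists 0.
have S_PAut s : s \in Sigma alpha -> s \in PAut C.
  rewrite inE => /predU1P[-> | /mapP[k _ ->]]; last exact: translations_PAut.
  by apply: in_PAut => x; rewrite permute1.
have stab s t x : s \in Sigma alpha -> t \in P -> x \in C ->
    permute t (permute s x) \in C.
  move=> Ss Pt Cx.
  exact: PAut_stable (P_PAut Pt) (PAut_stable (S_PAut _ Ss) Cx).
case E: [seq st <- _ | _] => [|[s t] l].
  (* The given pair passes: its syndrome has the weight of [e]. *)
  suff : (sigma, tau) \in [::] by [].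
  rewrite -E mem_filter; apply/andP; split.
    rewrite /= !permuteD linearD /= mulmxDr HC ?stab // add0r.
    by rewrite (wgt_syndrome stdH off) !wgt_permute.
  by apply/allpairsP; exists (sigma, tau).
have : (s, t) \in (s, t) :: l by rewrite mem_head.
rewrite -E mem_filter => /andP[pass /allpairsP[[s' t'] /= [Ss Pt [def_s def_t]]]].
rewrite -def_s in Ss; rewrite -def_t in Pt; rewrite /= !permuteD in pass *.
have off' := low_syndrome_off_information_set CB C_onto_I HC stdH K_gt0
  (stab _ _ _ Ss Pt Cc) _ pass.
rewrite (pick_codeword CB HC stdH) ?stab //=; first by rewrite !permuteK.
by apply: off'; rewrite !wgt_permute.
Qed.

End Decoder.

Theorem theorem19 (m n r1 r2 lambda0 : nat) (K : finFieldType) (alpha : K)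
    (phi : 'Z_n -> 'Z_r1 * 'Z_r2) (Talpha : {perm K})
  (hm : (2 < m)%N)
  (hn : n = (2 ^ m - 1)%N)
  (hr : n = (r1 * r2)%N)
  (hcop : coprime r1 r2)
  (hr1 : (1 < r1)%N)
  (hr2 : (1 < r2)%N)
  (hord : is_order_mod r1 2 m)
  (hK : #|K| = (2 ^ m)%N)
  (halpha : n.-primitive_root alpha)
  (hlambda0 : is_max
     (fun l => (1 <= l)%N /\ m%:Z < Num.ceil (r1%:R / l%:R : rat)) lambda0)
  (hphi : {morph phi : i j / i + j})
  (bij_phi : bijective phi)
  (hT0 : Talpha 0 = 0)
  (hT : forall i : nat, Talpha (alpha ^+ i) = alpha ^+ i.+1) :
  let C := RM1 K m in
  let s := ((lambda0 + 1) * r2 - 1)%N in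
  let I := CRT_set m alpha phi in
  [/\ information_set C I,
      <[Talpha]>%g \subset PAut_punctured C
    & forall (H : 'M['F_2]_(#|K| - dimension C, #|K|)) (P : seq {perm K}),
        parity_check_matrix C H -> standard_form I H ->
        uniq P -> P =i <[Talpha]>%g ->
        forall c e : word K, c \in C ->
          (wgt e <= s)%N -> (wgt e <= capability C)%N ->
          algorithmII C alpha I H P (c + e) = Some c].
Proof.
move=> C s I; have [psi phiK psiK] := bij_phi.
have [[l_gt0 lt_ceil] _] := hlambda0.
have lt_r1 : (lambda0 * m < r1)%N.
  (* For an integer m, m < ceil(r1 / lambda0) means m < r1 / lambda0. *)
  move: lt_ceil; rewrite ceil_gt_int ltr_pdivlMr ?ltr0n // -pmulrn.
  by rewrite -natrM ltr_nat mulnC.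
have m_lt_r1 : (m < r1)%N by apply: leq_ltn_trans lt_r1; rewrite leq_pmull.
have m_gt1 : (1 < m)%N by lia.
have n_gt1 : (1 < n)%N by rewrite hr; nia.
have alpha_nz : alpha != 0 := alpha_neq0 halpha.
(* [Talpha] is multiplication by [alpha], also at 0. *)
have TE k y : (Talpha ^+ k)%g y = alpha ^+ k * y.
  have [-> | y_nz] := eqVneq y 0.
    by elim: k => [|k IHk]; rewrite ?expg0 ?perm1 ?expgSr ?permM ?IHk !mulr0 // hT0.
  have [i ->] := nz_alpha m_gt1 hK hn halpha y_nz.
  elim: k => [|k IHk]; first by rewrite expg0 perm1 mul1r.
  by rewrite expgSr permM IHk -!exprD hT addSn.
have T_PAut tau : tau \in <[Talpha]>%g -> tau \in PAut C.
  case/cycleP => k ->; apply: (homothety_PAut m_gt1 hK hn halpha _ (TE k)).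
  by rewrite expf_neq0.
pose pw := CRT_power alpha psi.
have pwD : {morph pw : u v / u + v >-> u * v} := CRT_powerD n_gt1 halpha hphi phiK psiK.
have pwX := CRT_powerX n_gt1 halpha hphi phiK psiK.
have pw_prim := CRT_power_prim n_gt1 hr1 halpha hphi phiK psiK.
have IE : I = _ := CRT_setE n_gt1 hr1 m_lt_r1 halpha hphi phiK psiK.
have info : information_set C I.
  apply: (RM1_information_set m_gt1 hK hn halpha (b := fun i => pw (1, 0) ^+ i)).
  - exact: (card_CRT_set n_gt1 hr1 m_lt_r1 halpha hphi phiK psiK).
  - by rewrite IE setU11.
  - by move=> i; rewrite IE; apply/setU1r/imsetP; exists i.
  exact: (primitive_powers_span m_gt1 hK hord pw_prim).
split=> //.
  apply/subsetP => tau T_tau; apply: fixing0_PAut_punctured (T_PAut _ T_tau).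
  by case/cycleP: T_tau => k ->; rewrite TE mulr0.
move=> H P parityH stdH _ PE c e Cc we_s we_t.
have translations := translation_PAut m_gt1 hK hn halpha.
apply: (algorithmII_correct (RM1_sub m_gt1 hK hn halpha) info.2) => //.
- by move=> x; apply: parity_check_orthogonal parityH.
- by move=> tau; rewrite PE; apply: T_PAut.
have [sigma S_sigma e0] : exists2 sigma, sigma \in Sigma alpha &
    entry (permute sigma e) 0 = 0.
  have [e0 | e0] := eqVneq (entry e 0) 0.
    by exists 1%g; rewrite ?mem_head // permute1.
  (* The weight is at most t, below the length, so some position [g] is error free; translation by
     [g] sends it to g + g = 0. *)
  have : (#|[set g | entry e g != 0%R]| < #|K|)%N.
    rewrite -wgt_word; apply: leq_ltn_trans we_t (capability_lt _ _).
    by apply/card_gt0P; exists 0.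
  rewrite -(cardsC [set g | entry e g != 0]) -[X in (X < _)%N]addn0 ltn_add2l.
  case/card_gt0P => g; rewrite !inE negbK => /eqP g0.
  have g_nz : g != 0 by apply: contraNneq e0 => g_eq0; rewrite g_eq0 in g0; rewrite g0.
  exists (translation g).
    rewrite inE; apply/orP; right; have gn := expf_n m_gt1 hK hn g_nz.
    have [i ->] := prim_rootP halpha gn; apply: map_f.
    by rewrite mem_iota /= add0n hK -hn.
  suff tr0 : ((translation g)^-1)%g 0 = g by rewrite entry_permute tr0.
  apply: (@perm_inj _ (translation g)).
  by rewrite permKV permE (addrr_pchar2 (pchar2 hK)).
pose e' := permute sigma e.
(* The nonzero error positions, pulled back to pairs of residues. *)
pose B := [set u | entry e' (pw u) != 0].
have B_small : (#|B| <= (lambda0 + 1) * r2 - 1)%N.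
  apply: leq_trans we_s; rewrite -(wgt_permute sigma) wgt_word.
  rewrite -(card_imset _ (CRT_power_inj n_gt1 halpha psiK)); apply/subset_leq_card.
  by apply/subsetP => _ /imsetP[u + ->]; rewrite !inE.
have [u u_free] := free_window hr1 hr2 lt_r1 B_small.
(* This permutation divides by [pw u]: it moves the free window [pw u * pw (1, 0) ^+ k] onto the
   nonzero part of [I] and keeps the error-free position 0 fixed. *)
exists sigma, ((Talpha ^+ (psi u : nat))^-1)%g; split=> //.
  by rewrite PE groupV mem_cycle.
move=> g; rewrite IE entry_permute invgK TE => /setU1P[-> | /imsetP[k _ ->]].
  by rewrite mulr0.
have := u_free k; rewrite inE negbK pwD => /eqP.
by rewrite /pw pwX.
Qed.
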